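(* Let $\mathbb X\subseteq\mathbb R^{n_x}$ and $\mathbb U\subseteq\mathbb R^{n_u}$ be closed convex sets with $(0,0)\in\mathbb X\times\mathbb U$, let $A\in\mathbb R^{n_x\times n_x}$ and $B\in\mathbb R^{n_x\times n_u}$ with $\mathrm{rank}(B)=n_u\le n_x$, and let $L:\mathbb R^{n_x}\times\mathbb R^{n_u}\to\mathbb R$ be convex and non-negative with $L(0,0)=0$. Let $n=n_x+1$, $\mathsf f=\mathsf f_1+\mathsf f_2$ with $\mathsf f_2>0$, and let $$F=(G\ \ h)=\begin{pmatrix}G_1&0\\ G_2&h_2\end{pmatrix}\in\mathbb R^{\mathsf f\times n},\qquad G_1\in\mathbb R^{\mathsf f_1\times n_x},\ G_2\in\mathbb R^{\mathsf f_2\times n_x},\ h_2\in\mathbb R^{\mathsf f_2},$$ where $G_1x\le 0$ implies $x=0$, and all components of $h_2$ are strictly negative. For $z\in\mathbb R^{\mathsf f}$ let $P(z)=\{(x,y)\in\mathbb R^{n_x}\times\mathbb R: Gx+hy\le z\}$. Let $(F,E,V)$ be a configuration triplet with edge matrix $E\in\mathbb R^{\mathsf e\times\mathsf f}$ and vertex matrices $V_1,\dots,V_{\mathsf v}\in\mathbb R^{n\times\mathsf f}$, such that for every $z\in\mathbb R^{\mathsf f}$ with $Ez\le 0$ the point $V_1z$ is the unique minimizer of $\min_{(x,y)\in P(z)} y$. Write $V_i=(R_i^\intercal, s_i)^\intercal$ with $R_i\in\mathbb R^{n_x\times\mathsf f}$ and $s_i\in\mathbb R^{\mathsf f}$ (so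 $R_i$ consists of the first $n_x$ rows of $V_i$ and $s_i^\intercal$ is its last row). Then for every $z\in\mathbb R^{\mathsf f}$ the following statements are equivalent. 1. $P(z)\in\mathcal P(E)$ (that is, $Ez\le 0$), and $P(z)$ is the epigraph of an $L$-CLF. 2. $Ez\le 0$, $V_1z=0$, $R_iz\in\mathbb X$ for all $i\in\{1,\dots,\mathsf v\}$, and there exist $v_1,\dots,v_{\mathsf v}\in\mathbb U$ and a vector $y\in\mathbb R^{\mathsf v}$ such that, for all $i\in\{1,\dots,\mathsf v\}$, $$L(R_iz,v_i)+y_i\le s_i^\intercal z\qquad\text{and}\qquad GAR_iz+GBv_i+h\,y_i\le z .$$
   Context: Vector inequalities are componentwise. The epigraph of $M:\mathbb R^{n_x}\to\mathbb R\cup\{\infty\}$ is $\mathrm{epi}(M)=\{(x,y)\in\mathbb R^{n_x}\times\mathbb R: M(x)\le y\}$ and $\operatorname{dom}(M)=\{x: M(x)<\infty\}$. $M$ is called proper compact convex if $\operatorname{dom}(M)$ is non-empty and compact and $\mathrm{epi}(M)$ is a closed convex set. $M$ is positive definite if $M(0)=0$ and $M(x)>0$ for all $x\ne0$. $I_{\mathbb X}(x)=0$ if $x\in\mathbb X$ and $I_{\mathbb X}(x)=+\infty$ otherwise. $L$-CLF: a function $M:\mathbb R^{n_x}\to\mathbb R\cup\{\infty\}$ that is positive definite, proper compact convex, and satisfies, for all $x\in\mathbb R^{n_x}$, $$M(x)\ \ge\ \min_{u\in\mathbb U}\ L(x,u)+I_{\mathbb X}(x)+M(Ax+Bu).$$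 Configuration triplet: let $K_n=\{(0,\dots,0,\theta)^\intercal:\theta\ge0\}\subseteq\mathbb R^n$ and let $\oplus$ denote the Minkowski sum. The triplet $(F,E,V)$ with $F\in\mathbb R^{\mathsf f\times n}$, $E\in\mathbb R^{\mathsf e\times\mathsf f}$, $V_1,\dots,V_{\mathsf v}\in\mathbb R^{n\times\mathsf f}$ is a configuration triplet if for every $z\in\mathbb R^{\mathsf f}$ $$\{\xi\in\mathbb R^n: F\xi\le z\}=\mathrm{conv}(V_1z,\dots,V_{\mathsf v}z)\oplus K_n\quad\Longleftrightarrow\quad Ez\le0 .$$ $\mathcal P(E)=\{P(z): z\in\mathbb R^{\mathsf f},\ Ez\le 0\}$; writing $P(z)\in\mathcal P(E)$ for a given parameter $z$ means that this $z$ satisfies $Ez\le0$. *)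

(* Defs.v *)
From mathcomp Require Import all_boot all_order all_algebra.
From mathcomp Require Import all_classical all_reals.
From mathcomp Require Import topology normedtype convex.

Set Implicit Arguments.
Unset Strict Implicit.
Unset Printing Implicit Defensive.

Import Order.TTheory GRing.Theory Num.Theory.
Import numFieldNormedType.Exports.

Local Open Scope classical_set_scope.
Local Open Scope ring_scope.

Definition lecv {R : realType} {m : nat} (a b : 'cV[R]_m) : Prop :=
  forall i, a i 0 <= b i 0.

Notation "a <=cv b" := (lecv a b) (at level 70, no associativity) : ring_scope.

Definition minimum {d : Order.disp_t} {T : porderType d} (S : set T) (m : T)
  : Prop := S m /\ lbound S m.

Definition argmin {R : realType} {T : Type} (S : set T) (f : T -> R) : set T :=
  [set p | S p /\ forall q, S q -> f p <= f q].

(* The second factor is [R^o], the regular module over [R], because [R] itself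
   carries no module structure; the two are convertible. *)
Definition epi {R : realType} {n : nat} (M : 'cV[R]_n -> \bar R)
  : set ('cV[R]_n * R^o) := [set p | (M p.1 <= (p.2 : R)%:E)%E].

Definition dom {R : realType} {n : nat} (M : 'cV[R]_n -> \bar R)
  : set 'cV[R]_n := [set x | (M x < +oo)%E].

Definition proper_compact_convex {R : realType} {n : nat}
    (M : 'cV[R]_n -> \bar R) : Prop :=
  [/\ dom M !=set0, compact (dom M), closed (epi M) & convex_set (epi M)].

Definition positive_definite {R : realType} {n : nat}
    (M : 'cV[R]_n -> \bar R) : Prop :=
  M 0 = 0%E /\ forall x, x <> 0 -> (0 < M x)%E.

Definition indicator {R : realType} {T : Type} (X : set T) (x : T) : \bar R :=
  if x \in X then 0%E else +oo%E.

(* The first clause makes [M] a function into the reals extended by [+oo] only.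
   The minimum over [U] is required to be attained, possibly with value [+oo]. *)
Definition L_CLF {R : realType} {nx nu : nat}
    (X : set 'cV[R]_nx) (U : set 'cV[R]_nu)
    (A : 'M[R]_nx) (B : 'M[R]_(nx, nu))
    (L : 'cV[R]_nx * 'cV[R]_nu -> R) (M : 'cV[R]_nx -> \bar R) : Prop :=
  [/\ forall x, M x != -oo%E,
      positive_definite M,
      proper_compact_convex M &
      forall x, exists2 m : \bar R,
        minimum [set ((L (x, u))%:E + indicator X x
                      + M (A *m x + B *m u)%R)%E | u in U] m
        & (m <= M x)%E].

(* [ord_max] is unavailable here: the dimension is used at [nx + 1], which is not
   convertible to [nx.+1]. *)
Definition upward_ray {R : realType} {n : nat} : set 'cV[R]_n :=
  [set \col_(i < n) (if i.+1 == n :> nat then theta else 0)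
    | theta in [set theta : R | 0 <= theta]].

Definition conv_points {R : realType} {n v : nat} (p : 'I_v -> 'cV[R]_n)
  : set 'cV[R]_n :=
  [set \sum_(i < v) lambda i *: p i
    | lambda in [set lambda : 'I_v -> R |
        (forall i, 0 <= lambda i) /\ \sum_(i < v) lambda i = 1]].

Definition minkowski_sum {R : realType} {n : nat} (S T : set 'cV[R]_n)
  : set 'cV[R]_n := [set a + b | a in S & b in T].

Definition configuration_triplet {R : realType} {f n e v : nat}
    (F : 'M[R]_(f, n)) (E : 'M[R]_(e, f)) (V : 'I_v -> 'M[R]_(n, f)) : Prop :=
  forall z : 'cV[R]_f,
    [set xi : 'cV[R]_n | F *m xi <=cv z]
      = minkowski_sum (conv_points (fun i => V i *m z)) upward_ray
    <-> E *m z <=cv 0.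

Definition polyhedron {R : realType} {f n : nat} (G : 'M[R]_(f, n)) (h z : 'cV[R]_f)
  : set ('cV[R]_n * R^o) :=
  [set p | G *m p.1 + (p.2 : R) *: h <=cv z].

(* Main.v *)
Require Import Defs.
From mathcomp Require Import all_boot all_order all_algebra.
From mathcomp Require Import all_classical all_reals.
From mathcomp Require Import interval_inference topology normedtype derive convex.
From mathcomp Require Import lra.

(* Since the last rows of F bound y from below, P(z) is the epigraph of a
   function M, and Ez <= 0 turns P(z) into the convex hull of the vertices
   V_i z plus the upward ray. If M is an L-CLF, then evaluating its decrease
   condition at the vertices R_i z gives the v_i and y_i. Conversely, a point
   (x, M(x)) of P(z) dominates a convex combination of vertices; the same
   combination of the v_i is a feasible input at x, and convexity of L and of
   P(z) gives the decrease condition. That the minimum over U is attained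
   uses that dom(M) is compact, that B has a left inverse, and that a finite
   convex function on R^n is continuous. *)

Set Implicit Arguments.
Unset Strict Implicit.
Unset Printing Implicit Defensive.

Import Order.TTheory GRing.Theory Num.Theory.
Import numFieldNormedType.Exports.

Local Open Scope classical_set_scope.
Local Open Scope ring_scope.

(** * Convexity with real weights in [0, 1], and finite convex combinations *)

Lemma convex_setP (R : realType) (T : lmodType R) (C : set T) :
  convex_set C <-> forall (x y : T) (t : R), 0 <= t <= 1 -> C x -> C y ->
    C (t *: x + (1 - t) *: y).
Proof.
split=> [cC x y t /andP[t0 t1] Cx Cy|cC x y t]; last first.
  by rewrite !inE => Cx Cy; apply: cC => //; rewrite ge0 le1.
have := cC x y (Itv01 t0 t1); rewrite !inE; exact.
Qed.

Lemma convex_functionP (R : realType) (T : lmodType R) (f : T -> R) :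
  convex_function setT f <-> forall (x y : T) (t : R), 0 <= t <= 1 ->
    f (t *: x + (1 - t) *: y) <= t * f x + (1 - t) * f y.
Proof.
split=> [cf x y t /andP[t0 t1]|cf t x y _ _]; last first.
  by apply: cf; rewrite ge0 le1.
by have := cf (Itv01 t0 t1) x y; apply; rewrite inE.
Qed.

(** By induction: the first point is set apart, and the others are rescaled by their total weight
    [mu] into a convex combination of their own. When [mu] is zero no rescaling is possible, but
    then all the other weights vanish. *)
Lemma convex_set_sum (R : realType) (T : lmodType R) (C : set T) n
    (p : 'I_n -> T) (lambda : 'I_n -> R) :
  convex_set C -> (forall i, C (p i)) -> (forall i, 0 <= lambda i) ->
  \sum_(i < n) lambda i = 1 -> C (\sum_(i < n) lambda i *: p i).
Proof.
move=> /convex_setP cC; elim: n p lambda => [|n IHn] p lambda Cp lambda0.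
  by rewrite big_ord0 => /eqP; rewrite eq_sym oner_eq0.
rewrite !big_ord_recl /=; set mu := \sum_(i < n) _ => sum1.
have mu0 : 0 <= mu by apply: sumr_ge0.
have -> : lambda ord0 = 1 - mu by rewrite -sum1 addrK.
have [mu_eq0|mu_neq0] := eqVneq mu 0.
  rewrite mu_eq0 subr0 scale1r big1 ?addr0// => i _.
  have /eqP := mu_eq0; rewrite psumr_eq0// => /allP/(_ i).
  by rewrite mem_index_enum => /(_ isT)/eqP ->; rewrite scale0r.
have mu1 : mu <= 1 by rewrite -sum1 lerDr.
rewrite addrC; set q := \sum_(i < n) _.
have -> : q = mu *: \sum_(i < n) (lambda (lift ord0 i) / mu) *: p (lift ord0 i).
  rewrite scaler_sumr; apply: eq_bigr => i _.
  by rewrite scalerA mulrC divfK.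
apply: cC => //; first by rewrite mu0.
apply: IHn => [//|i|]; first by rewrite divr_ge0.
by rewrite -mulr_suml divff.
Qed.

(* Jensen's inequality, as convexity of the epigraph. *)
Lemma convex_function_sum (R : realType) (T : lmodType R) (f : T -> R) n
    (p : 'I_n -> T) (lambda : 'I_n -> R) :
  convex_function setT f -> (forall i, 0 <= lambda i) ->
  \sum_(i < n) lambda i = 1 ->
  f (\sum_(i < n) lambda i *: p i) <= \sum_(i < n) lambda i * f (p i).
Proof.
move=> /convex_functionP cf lambda0 sum1.
pose C : set (T * R^o)%type := [set q | f q.1 <= q.2].
have cC : convex_set C.
  apply/convex_setP => -[x a] [y b] t t01 /= xa yb.
  apply: le_trans (cf _ _ _ t01) _; have /andP[t0 t1] := t01.
  by rewrite lerD// ler_wpM2l// subr_ge0.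
have := @convex_set_sum _ _ C _ (fun i => (p i, f (p i) : R^o)) lambda cC
  (fun=> lexx _) lambda0 sum1.
by rewrite /C/= !raddf_sum.
Qed.

(** * Continuity of finite convex functions *)

(** For t in [0, 1] the point x + t e divides the segment from x to x + e, so the increment is at
    most t times the one at x + e. The term at x - e serves negative t and makes the bound
    symmetric. *)
Lemma convex_increment_line (R : realType) (T : lmodType R) (f : T -> R)
    (x e : T) (t : R) :
  convex_function setT f -> `|t| <= 1 ->
  f (x + t *: e) - f x <= `|t| * (`|f (x + e) - f x| + `|f (x - e) - f x|).
Proof.
move=> /convex_functionP cf.
wlog t0 : t e / 0 <= t => [wl|].
  have [/wl|/ltW t0 t1] := leP 0 t; first exact.
  have := wl (- t) (- e); rewrite scalerN scaleNr !opprK normrN oppr_ge0.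
  by rewrite [X in _ * X]addrC; apply.
rewrite ger0_norm// => t1.
have -> : x + t *: e = t *: (x + e) + (1 - t) *: x.
  by rewrite scalerDr scalerBl scale1r [RHS]addrC addrA subrK.
have /cf h : 0 <= t <= 1 by rewrite t0.
have -> : t * (`|f (x + e) - f x| + `|f (x - e) - f x|)
  = t * `|f (x + e) - f x| + t * `|f (x - e) - f x| by rewrite mulrDr.
rewrite ler_wpDr ?mulr_ge0//.
apply: (@le_trans _ _ (t * (f (x + e) - f x))); last first.
  by rewrite ler_wpM2l// ler_norm.
by have := h (x + e) x; lra.
Qed.

(** Averaging over the n axes reduces the bound to one line at a time. Each coordinate of [d] is
    then stretched by n, and n delta <= 1 keeps the stretched step within [-1, 1]. *)
Lemma convex_increment_le (R : realType) n (f : 'cV[R]_n -> R) (x d : 'cV[R]_n)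
    (delta : R) :
  convex_function setT f -> (forall i, `|d i 0| <= delta) -> n%:R * delta <= 1 ->
  f (x + d) - f x <= delta *
    \sum_(i < n) (`|f (x + delta_mx i 0) - f x| + `|f (x - delta_mx i 0) - f x|).
Proof.
case: n => [|n] in f x d *; move=> cf d_le n_le.
  by rewrite (_ : d = 0) ?addr0 ?subrr ?big_ord0 ?mulr0//; apply/colP => -[].
pose w : R := n.+1%:R^-1.
have wn : w * n.+1%:R = 1 by rewrite mulVf.
have sumw : \sum_(i < n.+1) w = 1 by rewrite sumr_const card_ord -mulr_natr.
have w0 : 0 <= w by rewrite invr_ge0.
(* x + d is the average of the points x + n d_i e_i. *)
have -> : x + d = \sum_(i < n.+1) w *: (x + (n.+1%:R * d i 0) *: delta_mx i 0).
  under eq_bigr do rewrite scalerDr scalerA mulrA wn mul1r.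
  rewrite big_split/= -scaler_suml sumw scale1r [in LHS](matrix_sum_delta d).
  by congr (_ + _); apply: eq_bigr => i _; rewrite big_ord1.
rewrite lerBlDr; apply: le_trans (convex_function_sum _ cf (fun=> w0) sumw) _.
have fx : f x = \sum_(i < n.+1) w * f x by rewrite -mulr_suml sumw mul1r.
rewrite -lerBlDr [X in _ - X <= _]fx -sumrB mulr_sumr.
apply: ler_sum => i _; rewrite -mulrBr.
have h : `|n.+1%:R * d i 0| <= 1.
  by rewrite normrM ger0_norm//; apply: le_trans n_le; rewrite ler_wpM2l.
apply: le_trans (ler_wpM2l w0 (convex_increment_line _ _ cf h)) _.
rewrite normrM ger0_norm// !mulrA wn mul1r ler_wpM2r// addr_ge0//.
Qed.

Lemma convex_continuous (R : realType) n (f : 'cV[R]_n -> R) :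
  convex_function setT f -> continuous f.
Proof.
move=> cf x; apply/(@cvgrPdist_le R R^o _ _ (nbhs_filter x)) => /= eps eps0.
set S := \sum_(i < n)
  (`|f (x + delta_mx i 0) - f x| + `|f (x - delta_mx i 0) - f x|).
have S0 : 0 <= S by apply: sumr_ge0 => i _; rewrite addr_ge0.
have nS : 0 < n%:R + 1 :> R by rewrite ltr_wpDl.
(* The first bound gives n delta <= 1, the second gives delta S <= eps; adding 1 keeps both
   denominators positive. *)
pose delta : R := Num.min (n%:R + 1)^-1 (eps / (S + 1)).
have delta0 : 0 < delta.
  by rewrite lt_min invr_gt0 nS divr_gt0// ltr_wpDl.
have n_delta : n%:R * delta <= 1.
  apply: (@le_trans _ _ (n%:R * (n%:R + 1)^-1)).
    by rewrite ler_wpM2l// ge_min lexx.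
  by rewrite ler_pdivrMr// mul1r lerDl.
have S_delta : delta * S <= eps.
  apply: (@le_trans _ _ (eps / (S + 1) * S)).
    by rewrite ler_wpM2r// ge_min lexx orbT.
  rewrite mulrAC ler_pdivrMr ?ltr_wpDl// ler_wpM2l ?lerDl//; exact: ltW.
apply/nbhs_ballP; exists delta => //= y [_ xy].
have d_le i : `|(y - x) i 0| <= delta.
  by rewrite !mxE distrC; apply: ltW; apply: xy.
have up := convex_increment_le x cf d_le n_delta.
(* The lower bound follows from the upper one at the reflected increment,
   because x is the midpoint of y and of its reflection. *)
have dN_le i : `|(- (y - x)) i 0| <= delta by rewrite mxE normrN.
have down := convex_increment_le x cf dN_le n_delta.
have half : 0 <= (2^-1 : R) <= 1 by apply/andP; split; lra.
move/convex_functionP: cf => /(_ (x + (y - x)) (x - (y - x)) 2^-1 half).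
have -> : 2^-1 *: (x + (y - x)) + (1 - 2^-1) *: (x - (y - x)) = x.
  by apply/colP => i; rewrite !mxE; lra.
move: up down; rewrite -/S [x + (y - x)]addrC subrK ler_norml => up down mid.
by apply/andP; split; lra.
Qed.

(** * Continuity, closedness and compactness for column vectors *)

Lemma continuous_mx (R : realType) (T : topologicalType) m n
    (f : T -> 'M[R]_(m, n)) :
  (forall i j, continuous (fun t => f t i j)) -> continuous f.
Proof.
move=> cf t S [P nbhsP PS].
have : \forall s \near t, forall i j, P i j (f s i j).
  by apply: filter_forall => i; apply: filter_forall => j; apply: cf.
by apply: filterS => s /= Ps; apply: PS.
Qed.

(** The set is a closed part of the transpose of a box of row vectors, which is compact as a product
    of segments. *)
Lemma bounded_closed_compact_cV (R : realType) n (A : set 'cV[R]_n) :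
  (forall i, exists C, forall x, A x -> `|x i 0| <= C) -> closed A -> compact A.
Proof.
move=> /choice[C AC] Acl.
have : compact ((trmx : 'rV[R]_n -> 'cV[R]_n) @`
    [set x : 'rV[R]_n | forall i, `[- C i, C i]%classic (x ord0 i)]).
  apply: continuous_compact.
    apply: continuous_subspaceT; apply: continuous_mx => i j.
    by under eq_fun do rewrite mxE; apply: coord_continuous.
  apply: (rV_compact (A := fun i => `[- C i, C i]%classic)) => i.
  exact: segment_compact.
move=> /(subclosed_compact Acl); apply=> x Ax; exists x^T; rewrite ?trmxK// => i.
by rewrite /= mxE in_itv/= -ler_norml AC.
Qed.

Lemma mulmx_coord_continuous (R : realType) m n (M : 'M[R]_(m, n)) i :
  continuous (fun x : 'cV[R]_n => (M *m x) i 0).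
Proof.
have -> : (fun x : 'cV[R]_n => (M *m x) i 0) = fun x => \sum_j M i j * x j 0.
  by apply/funext => x; rewrite mxE.
apply: continuous_big => [|j _ x].
  exact: (@pseudometric_normed_Zmodule.add_continuous _ R^o).
by apply: (@continuousM R); [exact: cst_continuous|exact: coord_continuous].
Qed.

Lemma continuous_addR (R : realType) (T : topologicalType) (f g : T -> R) :
  continuous f -> continuous g -> continuous (fun t => f t + g t).
Proof. by move=> cf cg t; apply: (@continuousD R R^o); [exact: cf|exact: cg]. Qed.

Lemma closed_lecv (R : realType) (T : topologicalType) m (f : T -> 'cV[R]_m)
    (z : 'cV[R]_m) :
  (forall i, continuous (fun t => f t i 0)) -> closed [set t | f t <=cv z].
Proof.
move=> cf; rewrite (_ : [set t | _] =
    \bigcap_i [set t | (fun t => f t i 0) t <= z i 0]); last first.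
  by apply/seteqP; split=> t //= ft i; [move=> _|]; exact: ft.
apply: closed_bigI => i _.
apply: (@preimage_closed _ _ (fun t => f t i 0) [set y | y <= z i 0]).
  by move=> t _; apply: cf.
exact: closed_le.
Qed.

(** * The polyhedron P(z), as an epigraph and through its vertices *)

Section polyhedron.
Context {R : realType} {n m : nat} (G : 'M[R]_(m, n)) (h z : 'cV[R]_m).

Lemma closed_polyhedron : closed (polyhedron G h z).
Proof.
apply: closed_lecv => i.
under eq_fun do rewrite !mxE.
apply: continuous_addR => [p|p]; last first.
  by apply: (@continuousM R); [exact: cvg_snd|exact: cst_continuous].
have := @mulmx_coord_continuous R m n G i p.1.
have -> : (fun q : 'cV[R]_n * R^o => \sum_j G i j * q.1 j 0)
    = (fun x : 'cV[R]_n => (G *m x) i 0) \o fst.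
  by apply/funext => q /=; rewrite mxE.
by move=> c; apply: continuous_comp c; exact: cvg_fst.
Qed.

Lemma convex_polyhedron : convex_set (polyhedron G h z).
Proof.
apply/convex_setP => -[x a] [y b] t /andP[t0 t1] xa yb i.
have {}t1 : 0 <= 1 - t by rewrite subr_ge0.
have := ler_wpM2l t0 (xa i); have := ler_wpM2l t1 (yb i).
rewrite /= mulmxDr -!scalemxAr !mxE /= /GRing.scale /=; lra.
Qed.

End polyhedron.

(** As [h2] is negative, row j of the second block says that y is at least the affine function
    [c j]. So M is the maximum of these finitely many functions where the first block holds, and +oo
    elsewhere. *)
Lemma polyhedron_epi (R : realType) n f1 f2 (G1 : 'M[R]_(f1, n))
    (G2 : 'M[R]_(f2, n)) (h2 : 'cV[R]_f2) (z : 'cV[R]_(f1 + f2)) :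
  (0 < f2)%N -> (forall j, h2 j 0 < 0) ->
  exists M : 'cV[R]_n -> \bar R,
    [/\ forall x, M x != -oo%E,
        polyhedron (col_mx G1 G2) (col_mx 0 h2) z = epi M &
        dom M = [set x | G1 *m x <=cv usubmx z]].
Proof.
move=> f2_gt0 h2_lt0.
pose c j (x : 'cV[R]_n) := ((G2 *m x) j 0 - dsubmx z j 0) / - h2 j 0.
(* The iterated maximum starts from a member of the family, so that the start value does not alter
   it; [f2_gt0] provides that member. *)
exists (fun x => if `[< G1 *m x <=cv usubmx z >]
  then (\big[Order.max/c (Ordinal f2_gt0) x]_(j < f2) c j x)%:E else +oo%E).
split=> [x||]; first by case: ifP.
  apply/seteqP; split=> [[x y]|[x y]]; rewrite /polyhedron /epi /=.
    rewrite mul_col_mx scale_col_mx scaler0 add_col_mx addr0 => xy.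
    rewrite asboolT; last first.
      by move=> i; have := xy (lshift f2 i); rewrite col_mxEu !mxE.
    rewrite lee_fin; apply/bigmax_leP.
    have cy j : c j x <= y.
      rewrite ler_pdivrMr ?oppr_gt0//.
      by have := xy (rshift f1 j); rewrite col_mxEd !mxE; lra.
    by split.
  case: asboolP => [xz|_]; last by rewrite leye_eq.
  rewrite lee_fin => /bigmax_leP[_ cy].
  rewrite mul_col_mx scale_col_mx scaler0 add_col_mx addr0 => i.
  rewrite -[z]vsubmxK; case: (split_ordP i) => j ->; rewrite ?col_mxEu ?col_mxEd.
    exact: xz.
  by have := cy j isT; rewrite ler_pdivrMr ?oppr_gt0// !mxE; lra.
apply/seteqP; split=> x; rewrite /dom /=; first by case: asboolP.
by move=> xz; rewrite asboolT// ltry.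
Qed.

(** The equality of sets in the triplet, read in coordinates (x, y): the ray moves only the last
    coordinate, so adding it amounts to relaxing the equation for y to an inequality. *)
Lemma configuration_polyhedron (R : realType) n f e v (G : 'M[R]_(f, n))
    (h : 'cV[R]_f) (E : 'M[R]_(e, f)) (V : 'I_v -> 'M[R]_(n + 1, f))
    (Rv : 'I_v -> 'M[R]_(n, f)) (s : 'I_v -> 'cV[R]_f) (z : 'cV[R]_f) :
  configuration_triplet (row_mx G h) E V ->
  (forall i, V i = col_mx (Rv i) (s i)^T) -> E *m z <=cv 0 ->
  forall (x : 'cV[R]_n) (y : R), polyhedron G h z (x, y) <->
    exists lambda : 'I_v -> R,
      [/\ forall i, 0 <= lambda i, \sum_(i < v) lambda i = 1,
          x = \sum_(i < v) lambda i *: (Rv i *m z) &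
          \sum_(i < v) lambda i * ((s i)^T *m z) 0 0 <= y].
Proof.
move=> FEV V_def /FEV zE x y.
have -> : polyhedron G h z (x, y) =
    [set xi | row_mx G h *m xi <=cv z] (col_mx x y%:M).
  by rewrite /polyhedron /= mul_row_col mul_mx_scalar.
have VE i : V i *m z = col_mx (Rv i *m z) (((s i)^T *m z) 0 0)%:M.
  by rewrite V_def mul_col_mx -mx11_scalar.
have rayE (theta : R) : \col_(i < n + 1) (if i.+1 == (n + 1)%N then theta else 0)
    = col_mx 0 theta%:M.
  apply/colP => i; rewrite mxE; case: (split_ordP i) => j ->.
    by rewrite col_mxEu mxE /= addn1 eqSS ltn_eqF.
  by rewrite col_mxEd ord1 !mxE /= addn0 addn1 eqxx.
have convE (lambda : 'I_v -> R) theta :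
    \sum_i lambda i *: (V i *m z) + col_mx 0 theta%:M
    = col_mx (\sum_i lambda i *: (Rv i *m z))
             (\sum_i lambda i * ((s i)^T *m z) 0 0 + theta)%:M.
  apply/colP => j; rewrite mxE summxE.
  under eq_bigr do rewrite VE mxE.
  case: (split_ordP j) => k ->.
    rewrite !col_mxEu mxE addr0 summxE; apply: eq_bigr => i _.
    by rewrite col_mxEu [RHS]mxE.
  rewrite !col_mxEd ord1 !mxE eqxx !mulr1n; congr (_ + _); apply: eq_bigr => i _.
  by rewrite col_mxEd !mxE eqxx mulr1n.
rewrite zE; split.
  move=> [_ [lambda [lambda0 sum1] <-]] [_ [theta /= theta0 <-]].
  rewrite rayE convE => /eq_col_mx[<- /matrixP/(_ 0 0)].
  rewrite !mxE eqxx !mulr1n => <-.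
  by exists lambda; split=> //; rewrite lerDl.
move=> [lambda [lambda0 sum1 -> sy]].
exists (\sum_i lambda i *: (V i *m z)); first by exists lambda.
(* The ray parameter is the slack in the inequality for y. *)
exists (col_mx 0 (y - \sum_(i < v) lambda i * ((s i)^T *m z) 0 0)%:M).
  exists (y - \sum_(i < v) lambda i * ((s i)^T *m z) 0 0) => //=.
  by rewrite subr_ge0.
by rewrite convE addrC subrK.
Qed.

(** * Attainment of the minimum over inputs *)

(** M takes the value +oo and is not assumed continuous. Passing to its closed epigraph leaves the
    continuous objective phi u + y and moves M into the constraint. *)
Lemma argmin_affine_composition (R : realType) nx nu (U : set 'cV[R]_nu)
    (phi : 'cV[R]_nu -> R) (B : 'M[R]_(nx, nu)) (a : 'cV[R]_nx)
    (M : 'cV[R]_nx -> \bar R) :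
  closed U -> U !=set0 -> continuous phi -> (forall u, 0 <= phi u) ->
  \rank B = nu -> (forall x, 0 <= M x)%E -> closed (epi M) -> compact (dom M) ->
  exists2 u, U u & forall w, U w ->
    ((phi u)%:E + M (a + B *m u)%R <= (phi w)%:E + M (a + B *m w)%R)%E.
Proof.
move=> Ucl [u0 Uu0] phi_c phi0 rkB M0 epi_cl dom_cp.
have [Moo|] := pselect (forall u, U u -> M (a + B *m u) = +oo%E).
  by exists u0 => // w Uw; rewrite !Moo.
move=> /existsNP[u1 /not_implyP[Uu1 /eqP Mu1]].
(* The left inverse [Bl] recovers u from a + B u, so inputs that lead into the compact [dom M] stay
   in a compact set. *)
have /row_fullP[Bl BlB] : row_full B by apply/eqP.
have affine_c m n (C : 'M[R]_(m, n)) b :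
    continuous (fun u : 'cV[R]_n => b + C *m u).
  apply: continuous_mx => i j; rewrite ord1; under eq_fun do rewrite mxE.
  by apply: continuous_addR; [exact: cst_continuous|exact: mulmx_coord_continuous].
have Mfin u : M (a + B *m u) != +oo%E ->
    exists2 y : R, M (a + B *m u) = y%:E & 0 <= y.
  by have := M0 (a + B *m u); case: (M _) => // y; rewrite lee_fin; exists y.
have [y1 My1 y10] := Mfin _ Mu1.
(* Minimize phi u + y over the pairs (u, y) of the epigraph below the level of a
   feasible point u1: these form a compact set. *)
pose c := phi u1 + y1.
pose S : set ('cV[R]_nu * R^o) :=
  [set p | [/\ U p.1, epi M (a + B *m p.1, p.2) & (p.2 : R) <= c]].
have y_ge0 (x : 'cV[R]_nx) (y : R) : epi M (x, y) -> 0 <= y.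
  by move=> /(le_trans (M0 x)); rewrite lee_fin.
have S_cp : compact S.
  have : compact (((fun x => - (Bl *m a) + Bl *m x) @` dom M) `*`
      (`[0, c]%classic : set R^o)).
    apply: compact_setX; last exact: segment_compact.
    by apply: continuous_compact dom_cp; exact/continuous_subspaceT/affine_c.
  move=> cp; apply: (subclosed_compact _ cp); last first.
    move=> [u y] [/= Uu My yc]; split=> /=; last first.
      by rewrite in_itv/= yc (y_ge0 _ _ My).
    exists (a + B *m u); first exact: le_lt_trans My (ltry _).
    by rewrite mulmxDr mulmxA BlB mul1mx addKr.
  rewrite (_ : S = ((fst @^-1` U) `&` ((fun p => (a + B *m p.1, p.2)) @^-1` epi M))
      `&` (snd @^-1` [set y | y <= c])); last first.
    by apply/seteqP; split=> [[u y] [? ? ?]|[u y] [[? ?] ?]]; split.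
  apply: closedI; first apply: closedI.
  - by apply: (@preimage_closed _ _ fst U) => // p _; exact: cvg_fst.
  - apply: (@preimage_closed _ _ (fun p : 'cV[R]_nu * R^o => (a + B *m p.1, p.2))
      (epi M)) => // p _.
    apply: (@cvg_pair _ _ _ _ (nbhs (a + B *m p.1)) (nbhs p.2));
      last exact: cvg_snd.
    by apply: continuous_comp (affine_c _ _ _ _ _); exact: cvg_fst.
  - apply: (@preimage_closed _ _ snd [set y : R^o | y <= c]) => [p _|].
      exact: cvg_snd.
    exact: closed_le.
have S_ne : S !=set0.
  by exists (u1, y1); split; rewrite //= /epi/= ?My1// /c lerDr.
have obj_c : continuous (fun p : 'cV[R]_nu * R^o => phi p.1 + (p.2 : R)).
  apply: continuous_addR => [p|p]; last exact: cvg_snd.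
  by apply: continuous_comp (phi_c _); exact: cvg_fst.
have [[u y] /[!inE] -[/= Uu My yc] umin] :=
  compact_EVT_min S_ne S_cp (continuous_subspaceT obj_c).
have {umin} umin w t : S (w, t) -> phi u + y <= phi w + (t : R).
  by move=> Sw; have := umin (w, t); apply; rewrite inE.
exists u => // w Uw.
have [->|/Mfin[t Mw t0]] := eqVneq (M (a + B *m w)) +oo%E.
  by rewrite addey// leey.
apply: (@le_trans _ _ (phi u + y)%:E); first by rewrite EFinD leeD2l.
rewrite Mw -EFinD lee_fin; have [tc|ct] := leP t c.
  by apply: umin; split; rewrite //= /epi/= Mw.
(* A competitor with t > c lies outside [S], but it costs at least t, which exceeds the cost c at
   [u1]. *)
apply: le_trans (umin u1 y1 _) _.
  by split; rewrite //= /epi/= ?My1// /c lerDr.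
by rewrite -/c; apply: le_trans (ltW ct) _; rewrite lerDr.
Qed.

(** * The vertices lie in P(z); the equivalence *)

Lemma configuration_vertex (R : realType) n f e v (G : 'M[R]_(f, n))
    (h : 'cV[R]_f) (E : 'M[R]_(e, f)) (V : 'I_v -> 'M[R]_(n + 1, f))
    (Rv : 'I_v -> 'M[R]_(n, f)) (s : 'I_v -> 'cV[R]_f) (z : 'cV[R]_f) (i : 'I_v) :
  configuration_triplet (row_mx G h) E V ->
  (forall i, V i = col_mx (Rv i) (s i)^T) -> E *m z <=cv 0 ->
  polyhedron G h z (Rv i *m z, ((s i)^T *m z) 0 0).
Proof.
move=> FEV V_def zE; apply/(configuration_polyhedron FEV V_def zE).
exists (fun j => (j == i)%:R); split=> [j||//|].
- by case: eqP.
- by rewrite (bigD1 i)//= eqxx big1 ?addr0// => j /negbTE ->.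
- rewrite (bigD1 i)//= eqxx scale1r big1 ?addr0// => j /negbTE ->.
  by rewrite scale0r.
- by rewrite (bigD1 i)//= eqxx mul1r big1 ?addr0// => j /negbTE ->; rewrite mul0r.
Qed.

Theorem theorem1 (R : realType) (nx nu f1 f2 e v : nat)
    (X : set 'cV[R]_nx) (U : set 'cV[R]_nu)
    (A : 'M[R]_nx) (B : 'M[R]_(nx, nu))
    (L : 'cV[R]_nx * 'cV[R]_nu -> R)
    (G1 : 'M[R]_(f1, nx)) (G2 : 'M[R]_(f2, nx)) (h2 : 'cV[R]_f2)
    (G : 'M[R]_(f1 + f2, nx)) (h : 'cV[R]_(f1 + f2))
    (F : 'M[R]_(f1 + f2, nx + 1)) (E : 'M[R]_(e, f1 + f2))
    (V : 'I_v.+1 -> 'M[R]_(nx + 1, f1 + f2))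
    (Rv : 'I_v.+1 -> 'M[R]_(nx, f1 + f2)) (s : 'I_v.+1 -> 'cV[R]_(f1 + f2))
    (X_closed : closed X) (X_convex : convex_set X) (X0 : X 0)
    (U_closed : closed U) (U_convex : convex_set U) (U0 : U 0)
    (B_rank : \rank B = nu) (nu_le_nx : (nu <= nx)%N)
    (L_convex : convex_function setT L)
    (L_ge0 : forall x u, 0 <= L (x, u)) (L0 : L (0, 0) = 0)
    (f2_gt0 : (0 < f2)%N)
    (G_def : G = col_mx G1 G2) (h_def : h = col_mx 0 h2)
    (F_def : F = row_mx G h)
    (G1_inj : forall x, G1 *m x <=cv 0 -> x = 0)
    (h2_lt0 : forall j, h2 j 0 < 0)
    (FEV : configuration_triplet F E V)
    (V_def : forall i, V i = col_mx (Rv i) (s i)^T)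
    (V1_min : forall z, E *m z <=cv 0 ->
      argmin (polyhedron G h z) snd
        = [set (Rv ord0 *m z, ((s ord0)^T *m z) 0 0)])
    (z : 'cV[R]_(f1 + f2)) :
  (E *m z <=cv 0 /\ exists2 M, L_CLF X U A B L M & polyhedron G h z = epi M)
  <->
  [/\ E *m z <=cv 0,
      V ord0 *m z = 0,
      forall i, X (Rv i *m z) &
      exists (w : 'I_v.+1 -> 'cV[R]_nu) (y : 'cV[R]_v.+1),
        forall i,
          [/\ U (w i),
              L (Rv i *m z, w i) + y i 0 <= ((s i)^T *m z) 0 0 &
              G *m A *m Rv i *m z + G *m B *m w i + y i 0 *: h <=cv z]].

Proof.
rewrite F_def in FEV.
have vertex i zE := configuration_vertex (z := z) i FEV V_def zE.
have V0E : V ord0 *m z = col_mx (Rv ord0 *m z) (((s ord0)^T *m z) 0 0)%:M.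
  by rewrite V_def mul_col_mx -mx11_scalar.
split=> [[zE [M [M_noo [M0 Mpos] _ clf] PM]]|[zE Vz0 RX [w [y wy]]]].
  have M_ge0 x : (0 <= M x)%E.
    by have [->|/eqP/Mpos/ltW//] := eqVneq x 0; rewrite M0.
  split=> //.
  (* The origin is a lowest point of the epigraph, and the lowest point of P(z) is unique, so it is
     V_1 z. *)
  - have : argmin (polyhedron G h z) snd ((0, 0) : 'cV[R]_nx * R^o).
      rewrite PM; split=> [|[x y] /= xy]; first by rewrite /epi /= M0.
      by have := le_trans (M_ge0 _) xy; rewrite lee_fin.
    rewrite (V1_min _ zE) V0E => -[<- <-].
    by rewrite raddf0 col_mx0.
  (* M is finite at a vertex, hence so is the minimum there; outside X the indicator would make it
     +oo. *)
  - move=> i; have [m [[u Uu <-] _]] := clf (Rv i *m z).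
    have : (M (Rv i *m z) < +oo)%E.
      by have := vertex i zE; rewrite PM => /le_lt_trans; apply; exact: ltry.
    move=> /[swap] /le_lt_trans /[apply].
    rewrite /indicator; case: ifP => [/set_mem//|_].
    by rewrite addey// addye ?M_noo.
  (* Take v_i to be a minimizing input at vertex i and y_i the value of M at its successor, which is
     finite because the decrease condition bounds it. *)
  - have /choice[wy wyP] : forall i, exists p : 'cV[R]_nu * R,
        [/\ U p.1, L (Rv i *m z, p.1) + p.2 <= ((s i)^T *m z) 0 0 &
          epi M (A *m (Rv i *m z) + B *m p.1, p.2)].
      move=> i; have := vertex i zE; rewrite PM {1}/epi /=.
      have [m [[u Uu <-] _] /le_trans /[apply]] := clf (Rv i *m z).
      rewrite /indicator; case: ifP => _; last first.
        by rewrite addey// addye ?M_noo.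
      rewrite adde0 /epi /=; have := M_noo (A *m (Rv i *m z) + B *m u).
      case My : (M _) => [t| |] //= _.
      by rewrite -EFinD lee_fin => Lt; exists (u, t); split=> //=; rewrite My.
    exists (fun i => (wy i).1), (\col_i (wy i).2) => i; rewrite mxE.
    have [Uw Lw] := wyP i; rewrite -PM /polyhedron /= => Pw; split=> //.
    by move: Pw; rewrite mulmxDr !mulmxA.
(* Conversely, V_1 z = 0 makes (0, 0) the unique lowest point of P(z). This yields M >= 0 and,
   further on, positive definiteness. *)
move: (Vz0); rewrite V0E => /eqP; rewrite col_mx_eq0 => /andP[/eqP R0 /eqP s0].
have {}s0 : ((s ord0)^T *m z) 0 0 = 0.
  by move/matrixP: s0 => /(_ 0 0); rewrite !mxE eqxx mulr1n.
have := V1_min _ zE; rewrite R0 s0 => argmin0.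
have [P00 P_ge0] : argmin (polyhedron G h z) snd ((0, 0) : 'cV[R]_nx * R^o).
  by rewrite argmin0.
have [M [M_noo]] := polyhedron_epi G1 G2 z f2_gt0 h2_lt0.
rewrite -G_def -h_def => PM domM.
have M_ge0 x : (0 <= M x)%E.
  have := M_noo x; case Mx : (M x) => [t| |] //= _; rewrite lee_fin.
  by apply: (P_ge0 (x, t : R^o)); rewrite PM /epi /= Mx.
have M_vertices := configuration_polyhedron FEV V_def zE.
have P_convex : convex_set (polyhedron G h z) by exact: convex_polyhedron.
have P_closed : closed (polyhedron G h z) by exact: closed_polyhedron.
(* A point of [dom M] is a convex combination of the R_j z, with weights at most 1. *)
have dom_bounded i : exists C, forall x, dom M x -> `|x i 0| <= C.
  exists (\sum_j `|(Rv j *m z) i 0|) => x.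
  rewrite /dom /=; have := M_noo x; case Mx : (M x) => [t| |] //= _ _.
  have : polyhedron G h z (x, t) by rewrite PM /epi /= Mx.
  move=> /M_vertices[lambda [lambda0 sum1 -> _]]; rewrite summxE.
  apply: le_trans (ler_norm_sum _ _ _) _; apply: ler_sum => j _.
  rewrite mxE normrM ger0_norm// ler_piMl// -sum1 (bigD1 j)//= lerDl.
  exact: sumr_ge0.
have dom_closed : closed (dom M).
  by rewrite domM; apply: closed_lecv => i; exact: mulmx_coord_continuous.
have dom_compact := bounded_closed_compact_cV dom_bounded dom_closed.
have epi_closed : closed (epi M) by rewrite -PM.
have descent x t : M x = t%:E -> X x /\ exists2 u, U u &
    ((L (x, u))%:E + M (A *m x + B *m u)%R <= t%:E)%E.
  move=> Mx; have : polyhedron G h z (x, t) by rewrite PM /epi /= Mx.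
  move=> /M_vertices[lambda [lambda0 sum1 -> st]].
  split; first exact: convex_set_sum.
  exists (\sum_i lambda i *: w i).
    by apply: convex_set_sum => // i; case: (wy i).
  set x' := \sum_i _; set u := \sum_i _.
  have Ly : L (x', u) <= \sum_i lambda i * L (Rv i *m z, w i).
    have := convex_function_sum (fun i => (Rv i *m z, w i)) L_convex lambda0 sum1.
    by rewrite [X in L X]surjective_pairing !raddf_sum.
  have : epi M (A *m x' + B *m u, \sum_i lambda i * y i 0).
    (* The pairs formed by the successor of vertex i and y_i lie in P(z), hence so does their
       combination. By linearity its first component is the successor of x' under u. *)
    have : epi M (\sum_i lambda i *: (A *m (Rv i *m z) + B *m w i, y i 0 : R^o)).
      rewrite -PM; apply: convex_set_sum => // i; have [_ _] := wy i.
      by rewrite /polyhedron /= mulmxDr !mulmxA.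
    rewrite [X in epi M X]surjective_pairing !raddf_sum /=.
    under eq_bigr do rewrite scalerDr (scalemxAr _ A) (scalemxAr _ B).
    by rewrite big_split /= -!mulmx_sumr.
  rewrite /epi /= => /(leeD2l (L (x', u))%:E)/le_trans; apply.
  rewrite -EFinD lee_fin; apply: le_trans st; apply: le_trans (lerD Ly (lexx _)) _.
  rewrite -big_split /=; apply: ler_sum => i _.
  by rewrite -mulrDr ler_wpM2l//; case: (wy i).
split=> //; exists M => //; split=> //.
- split=> [|x /eqP x0].
    apply/le_anti/andP; split=> //.
    by move: P00; rewrite PM.
  rewrite lt_neqAle M_ge0 andbT; apply: contra_neq x0 => Mx0.
  (* If M x = 0, then (x, 0) is a lowest point too, and uniqueness forces x = 0. *)
  have : argmin (polyhedron G h z) snd ((x, 0) : 'cV[R]_nx * R^o).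
    by split=> [|q /P_ge0//]; rewrite PM /epi /= -Mx0.
  by rewrite argmin0 => -[].
- split=> //; rewrite -?PM//.
  exists 0; rewrite /dom /=; move: P00; rewrite PM => /le_lt_trans; apply.
  exact: ltry.
- move=> x.
  have Lx_convex : convex_function setT (fun u => L (x, u)).
    apply/convex_functionP => u1 u2 t t01.
    move/convex_functionP: L_convex => /(_ (x, u1) (x, u2) t t01).
    rewrite (_ : t *: (x, u1) + _ = (x, t *: u1 + (1 - t) *: u2))//.
    by congr (_, _); rewrite /= -scalerDl addrC subrK scale1r.
  have [u Uu umin] := argmin_affine_composition (A *m x) U_closed
    (ex_intro _ _ U0) (convex_continuous Lx_convex) (L_ge0 x) B_rank M_ge0
    epi_closed dom_compact.
  (* Outside X the objective is constantly +oo, so [u] still attains the minimum there. *)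
  pose obj q := ((L (x, q))%:E + indicator X x + M (A *m x + B *m q)%R)%E.
  have objE q : obj q = if x \in X
      then ((L (x, q))%:E + M (A *m x + B *m q)%R)%E else +oo%E.
    rewrite /obj /indicator; case: ifP => _; first by rewrite adde0.
    by rewrite addey// addye ?M_noo.
  exists (obj u).
    split=> [|_ [q Uq <-]]; first by exists u.
    by rewrite -/(obj q) !objE; case: ifP => // _; exact: umin.
  (* Only a finite M x needs an argument; [descent] then puts x in X and supplies an input that is
     good enough. *)
  have := M_noo x; case Mx : (M x) => [t| |] //= _; last exact: leey.
  have [xX [u' Uu' Lu']] := descent x t Mx.
  by rewrite objE mem_set//; apply: le_trans (umin _ Uu') Lu'.
Qed.
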